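(* Let $T:[0,1]\to[0,1]$ be an expanding Markov map with a finite partition, and let $\nu$ be a $T$-invariant ergodic Borel probability measure on $[0,1]$. Then for every $\kappa>0$, both $x\mapsto\lambda(\mathcal U^\kappa(x))$ and $x\mapsto\dim_H\mathcal U^\kappa(x)$ are constant $\nu$-almost surely.
   Context: An expanding Markov map with a finite partition is a map $T:[0,1]\to[0,1]$ for which there are points $0=a_0<a_1<\dots<a_Q=1$, with $I(i)=(a_i,a_{i+1})$ for $i=0,\dots,Q-1$, such that: (1) there are an integer $n_0$ and a real $\rho>1$ with $|(T^{n_0})'|\ge\rho$; (2) $T$ is strictly monotonic on each $I(i)$ and extends to a $C^2$ function on each $\overline{I(i)}$; (3) if $I(j)\cap T(I(k))\ne\emptyset$ then $I(j)\subset T(I(k))$; (4) there is an integer $R$ such that $I(j)\subset\bigcup_{n=1}^R T^n(I(k))$ for all $j,k$; (5) for every $k$, $\sup_{(x,y,z)\in I(k)^3}|T''(x)|/(|T'(y)||T'(z)|)<\infty$. $\lambda$ denotes Lebesgue measure on $[0,1]$, $\dim_H$ Hausdorff dimension, $B(x,r)$ the open ball of center $x$ and radius $r$. For $\kappa>0$ and $x\in[0,1]$, $\mathcal U^\kappa(x)=\{y\in[0,1]:\text{for all sufficiently large } N \text{ there is } 1\le n\le N \text{ with } |T^nx-y|<N^{-\kappa}\}=\bigcup_{i\ge1}\bigcap_{N\ge i}\bigcup_{n=1}^N B(T^nx,N^{-\kappa})$. *)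

(* Defs.v *)
From HB Require Import structures.
From mathcomp Require Import all_boot all_order all_algebra.
From mathcomp Require Import all_classical all_reals all_analysis.
Set Implicit Arguments. Unset Strict Implicit. Unset Printing Implicit Defensive.
Import Order.TTheory GRing.Theory Num.Theory.
Import numFieldNormedType.Exports.
Local Open Scope classical_set_scope.
Local Open Scope ring_scope.

Section Defs.
Variable R : realType.

Definition unitI : set R := `[0, 1]%classic.

Definition Ipart (a : nat -> R) (i : nat) : set R := `](a i), (a i.+1)[%classic.

Definition C2 (g : R -> R) : Prop :=
  (forall x, derivable g x 1) /\ (forall x, derivable (derive1 g) x 1) /\
  continuous (derive1n 2 g).

Definition expanding_markov_map (T : R -> R) : Prop :=
  (forall x, x \in unitI -> T x \in unitI) /\
  exists (Q : nat) (a : nat -> R),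
    (0 < Q)%N /\ a 0%N = 0 /\ a Q = 1 /\
    (forall i, (i < Q)%N -> a i < a i.+1) /\
    (* (1) expansion of some iterate, at every point whose orbit up to time
       n0-1 stays in the union of the open intervals (where T^n0 is
       differentiable) *)
    (exists (n0 : nat) (rho : R), (0 < n0)%N /\ 1 < rho /\
       forall x, x \in unitI ->
         (forall k, (k < n0)%N -> exists2 i, (i < Q)%N & iter k T x \in Ipart a i) ->
         rho <= `| derive1 (iter n0 T) x |) /\
    (forall i, (i < Q)%N ->
       ((forall x y, x \in Ipart a i -> y \in Ipart a i -> x < y -> T x < T y) \/
        (forall x y, x \in Ipart a i -> y \in Ipart a i -> x < y -> T y < T x)) /\
       exists g : R -> R, C2 g /\ forall x, x \in Ipart a i -> g x = T x) /\
    (forall j k, (j < Q)%N -> (k < Q)%N ->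
       Ipart a j `&` (T @` Ipart a k) !=set0 -> Ipart a j `<=` T @` Ipart a k) /\
    (exists Rn : nat, forall j k, (j < Q)%N -> (k < Q)%N ->
       Ipart a j `<=` \bigcup_(n in [set n : nat | (1 <= n <= Rn)%N])
                        (iter n T @` Ipart a k)) /\
    (forall k, (k < Q)%N -> exists M : R,
       forall x y z, x \in Ipart a k -> y \in Ipart a k -> z \in Ipart a k ->
         derive1 T y != 0 /\ derive1 T z != 0 /\
         `| derive1n 2 T x | / (`| derive1 T y | * `| derive1 T z |) <= M).

Definition T_invariant (T : R -> R) (nu : probability (measurableTypeR R) R) : Prop :=
  forall A : set (measurableTypeR R), measurable A ->
    nu (unitI `&` T @^-1` A) = nu A.

Definition T_ergodic (T : R -> R) (nu : probability (measurableTypeR R) R) : Prop :=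
  forall A : set (measurableTypeR R), measurable A -> A `<=` unitI ->
    unitI `&` T @^-1` A = A -> (nu A = 0 \/ nu A = 1)%E.

Definition diam (U : set R) : \bar R :=
  ereal_sup [set (`| x - y |)%:E | x in U & y in U].

Definition diam_pow (s : R) (U : set R) : \bar R :=
  if pselect (U !=set0) is left _ then
    (if diam U is r%:E then (powR r s)%:E else +oo)%E
  else 0%E.

Definition hausdorff_delta (s delta : R) (E : set R) : \bar R :=
  ereal_inf [set (\sum_(i <oo) diam_pow s (U i))%E |
             U in [set U : nat -> set R |
                   E `<=` \bigcup_i U i /\ forall i, (diam (U i) <= delta%:E)%E]].

Definition hausdorff_measure (s : R) (E : set R) : \bar R :=
  ereal_sup [set hausdorff_delta s delta E | delta in [set d : R | 0 < d]].

Definition hausdorff_dim (E : set R) : \bar R :=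
  ereal_inf [set s%:E | s in [set s : R | 0 <= s /\ hausdorff_measure s E = 0%E]].

Definition Ukappa (T : R -> R) (kappa : R) (x : R) : set R :=
  [set y | y \in unitI /\
     exists i : nat, (1 <= i)%N /\ forall N : nat, (i <= N)%N ->
       exists n : nat, (1 <= n <= N)%N /\
         `| iter n T x - y | < powR N%:R (- kappa)].

End Defs.

(* Main.v *)
(** [U x] minus the point [T x] is contained in [U (T x)], so Lebesgue measure
    and the failure of [H^s (U x) = 0] can only increase along orbits; by
    ergodicity every forward invariant Borel event has measure 0 or 1, and
    countably many such events determine both quantities. The substance is
    measurability. For Lebesgue measure this is Tonelli's theorem. For the
    dimension, replacing open balls by closed ones changes [U x] by a countable
    set only and makes it a countable union of compact sets [Kset i x]; being
    [H^s]-null then amounts to having finite covers by rational balls of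
    arbitrarily small cost, and by compactness [Kset i x] being covered by a
    given finite family of rational balls is a Borel condition on the orbit. *)

Require Import Defs.
From HB Require Import structures.
From mathcomp Require Import all_boot all_order all_algebra.
From mathcomp Require Import all_classical all_reals all_analysis.
From mathcomp Require Import measurable_realfun lra.
Set Implicit Arguments.
Unset Strict Implicit.
Unset Printing Implicit Defensive.
Import Order.TTheory GRing.Theory Num.Theory.
Import numFieldNormedType.Exports.
Local Open Scope classical_set_scope.
Local Open Scope ring_scope.

Section HausdorffNull.
Variable R : realType.
Implicit Types (s t : R) (E F U : set R) (p : rat * rat).

Definition qball p : set R := [set y | `|y - ratr p.1| < ratr p.2].

Definition qcost s p : R := ratr p.2 `^ s.

Definition snull s E := forall e : R, 0 < e ->
  exists p : nat -> rat * rat, E `<=` \bigcup_i qball (p i) /\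
    (\sum_(i <oo) (qcost s (p i))%:E <= e%:E)%E.

Lemma diam_ge0 U : U !=set0 -> (0 <= diam U)%E.
Proof.
move=> [x Ux]; apply: ereal_sup_ubound; exists x => //; exists x => //.
by rewrite subrr normr0.
Qed.

Lemma diam_pow_ge0 s U : (0 <= diam_pow s U)%E.
Proof.
rewrite /diam_pow; case: pselect => // -[x Ux]; case: (diam U) => [r| |] //=.
by rewrite lee_fin powR_ge0.
Qed.

Lemma diam_qball p : (diam (qball p) <= (2 * ratr p.2)%:E)%E.
Proof.
apply: ge_ereal_sup => _ [x xp [y yp <-]]; rewrite lee_fin.
rewrite (le_trans (ler_distD (ratr p.1) _ _))// [X in _ + X]distrC.
by have := ltW xp; have := ltW yp; lra.
Qed.

Lemma diam_pow_qball s p : 0 <= s ->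
  (diam_pow s (qball p) <= (2 `^ s * qcost s p)%:E)%E.
Proof.
move=> s0; rewrite /diam_pow; case: pselect => [p0|_]; last first.
  by rewrite lee_fin mulr_ge0// powR_ge0.
have r0 : 0 <= ratr p.2 :> R.
  by case: p0 => y; rewrite /qball/= => /ltW; exact: le_trans.
have := diam_qball p; have := diam_ge0 p0.
case: (diam _) => [d| |]//; rewrite !lee_fin => d0 dr.
rewrite /qcost -powRM// ge0_ler_powR// nnegrE//; lra.
Qed.

(* The radius [rho] below satisfies [rho ^ s = (diam U) ^ s + e], which leaves
   room for a rational centre and a rational radius. *)
Lemma qball_cover s e U : 0 < s -> 0 < e -> (diam U <= 1)%E ->
  exists p, U `<=` qball p /\ ((qcost s p)%:E <= diam_pow s U + e%:E)%E.
Proof.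
move=> s0 e0 U1; rewrite /diam_pow; case: pselect => [[x Ux]|U0]; last first.
  exists (0, 0); split; first by move=> y Uy; case: U0; exists y.
  by rewrite /qcost/= rmorph0 powR0 ?gt_eqF// add0e lee_fin ltW.
have U0 : U !=set0 by exists x.
have := diam_ge0 U0; case Ud: (diam U) U1 => [d| |]// _; rewrite lee_fin => d0.
have ds0 : 0 <= d `^ s by exact: powR_ge0.
pose rho := (d `^ s + e) `^ s^-1.
have rhoE : rho `^ s = d `^ s + e.
  by rewrite /rho -powRrM mulVf ?gt_eqF// powRr1// addr_ge0// ltW.
have dr : d < rho.
  rewrite ltNge; apply/negP => rd.
  have : rho `^ s <= d `^ s.
    by rewrite ge0_ler_powR ?nnegrE ?powR_ge0// ltW.
  by rewrite rhoE; lra.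
have [c] : exists q : rat, ratr q \in `]x, (x + (rho - d) / 2)[.
  by apply: rat_in_itvoo; lra.
have [r] : exists q : rat, ratr q \in `](d + (rho - d) / 2), rho[.
  by apply: rat_in_itvoo; lra.
rewrite !in_itv/= => /andP[r1 r2] /andP[c1 c2].
exists (c, r); split.
  move=> y Uy; rewrite /qball/=.
  have : (`|y - x|%:E <= diam U)%E.
    by apply: ereal_sup_ubound; exists y => //; exists x.
  rewrite Ud lee_fin => yx.
  rewrite (le_lt_trans (ler_distD x _ _))//.
  have -> : `|x - ratr c| = ratr c - x by rewrite distrC gtr0_norm// subr_gt0.
  by lra.
rewrite -EFinD lee_fin -rhoE /qcost/= ge0_ler_powR ?nnegrE ?powR_ge0//; lra.
Qed.

Lemma hausdorff_delta_ge0 s delta E : (0 <= hausdorff_delta s delta E)%E.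
Proof.
apply: le_ereal_inf_tmp => _ [U _ <-]; apply: nneseries_ge0 => i _ _.
exact: diam_pow_ge0.
Qed.

Lemma snull_hausdorff_delta1 s E : 0 < s ->
  (hausdorff_delta s 1 E <= 0)%E -> snull s E.
Proof.
move=> s0 Hs e e0.
have H0 : hausdorff_delta s 1 E = 0%E.
  by apply/eqP; rewrite eq_le Hs hausdorff_delta_ge0.
have e20 : 0 < e / 2 by rewrite divr_gt0.
have : hausdorff_delta s 1 E \is a fin_num by rewrite H0.
move=> /(lb_ereal_inf_adherent e20) -[_ [U [EU U1] <-]].
rewrite -/(hausdorff_delta s 1 E) H0 add0e => Ue.
have /choice[p pU] : forall i, exists p, U i `<=` qball p /\
    ((qcost s p)%:E <= diam_pow s (U i) + ((e / 2) / (2 ^ i.+1)%:R)%:E)%E.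
  by move=> i; apply: qball_cover => //; rewrite divr_gt0// ltr0n expn_gt0.
exists p; split.
  by move=> y /EU[i _ Uy]; exists i => //; apply: (pU i).1.
apply: (@le_trans _ _
  (\sum_(i <oo) (diam_pow s (U i) + ((e / 2) / (2 ^ i.+1)%:R)%:E))%E).
  apply: lee_nneseries => i _; first by rewrite lee_fin powR_ge0.
  exact: (pU i).2.
apply: (le_trans (epsilon_trick _ (fun i => diam_pow_ge0 s (U i)) (ltW e20))).
by rewrite [e in leRHS](splitr e) EFinD leeD2r// ltW.
Qed.

Lemma hausdorff_measure_snull s E : 0 < s -> snull s E ->
  hausdorff_measure s E = 0%E.
Proof.
move=> s0 Es.
have Hd delta : 0 < delta -> hausdorff_delta s delta E = 0%E.
  move=> d0; apply/eqP; rewrite eq_le hausdorff_delta_ge0 andbT.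
  apply/lee_addgt0Pr => e e0; rewrite add0e.
  have c0 : 0 < 2 `^ s :> R by rewrite powR_gt0.
  pose e' := Num.min (e / 2 `^ s) ((delta / 2) `^ s).
  have e'0 : 0 < e' by rewrite lt_min divr_gt0//= powR_gt0// divr_gt0.
  have [p [Ep pe]] := Es _ e'0.
  have pe' i : qcost s (p i) <= e'.
    rewrite -lee_fin (le_trans _ pe)//.
    apply: le_trans (nneseries_lim_ge i.+1 _); last first.
      by move=> k _ _; rewrite lee_fin powR_ge0.
    rewrite big_nat_recr//= leeDr// sume_ge0// => k _.
    by rewrite lee_fin powR_ge0.
  apply: (@le_trans _ _ (\sum_(i <oo) diam_pow s (qball (p i)))%E).
    apply: ereal_inf_lbound; exists (fun i => qball (p i)) => //; split=> // i.
    apply: (le_trans (diam_qball _)); rewrite lee_fin.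
    have [r0|r0] := leP (ratr (p i).2) (0 : R).
      by rewrite (le_trans _ (ltW d0))// mulr_ge0_le0.
    rewrite -ler_pdivlMl// mulrC leNgt; apply/negP => dr.
    have := pe' i; rewrite le_min => /andP[_]; rewrite leNgt => /negP; apply.
    by rewrite /qcost gt0_ltr_powR// nnegrE ltW// divr_gt0.
  apply: (@le_trans _ _ (\sum_(i <oo) ((2 `^ s)%:E * (qcost s (p i))%:E))%E).
    apply: lee_nneseries => i _; first by move=> _; exact: diam_pow_ge0.
    by rewrite -EFinM diam_pow_qball// ltW.
  rewrite nneseriesZl; last by move=> i _; rewrite lee_fin powR_ge0.
  apply: (@le_trans _ _ ((2 `^ s)%:E * e'%:E)%E).
    by rewrite lee_pmul2l// lte_fin.
  by rewrite -EFinM lee_fin mulrC -ler_pdivlMr// ge_min lexx.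
apply/eqP; rewrite eq_le; apply/andP; split.
  by apply: ge_ereal_sup => _ [d /= d0 <-]; rewrite Hd.
by apply: ereal_sup_ubound; exists 1 => //=; rewrite Hd.
Qed.

Lemma hausdorff_measure_eq0 s delta E : 0 < delta ->
  hausdorff_measure s E = 0%E -> (hausdorff_delta s delta E <= 0)%E.
Proof. by move=> d0 <-; apply: ereal_sup_ubound; exists delta. Qed.

Lemma hausdorff_measure_snullP s E : 0 < s ->
  hausdorff_measure s E = 0%E <-> snull s E.
Proof.
move=> s0; split; last exact: hausdorff_measure_snull.
by move=> /(hausdorff_measure_eq0 ltr01)/snull_hausdorff_delta1; exact.
Qed.

Lemma powR_antimono (d s t : R) : 0 <= d <= 1 -> 0 <= s <= t -> d `^ t <= d `^ s.
Proof.
move=> /andP[d0 d1] /andP[s0 st].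
have [->|dn0] := eqVneq d 0.
  rewrite /powR eqxx ler_nat; have [t0|//] := eqVneq t 0.
  by rewrite eq_le s0 -t0 st.
rewrite /powR (negbTE dn0) ler_expR.
have : ln d <= 0 by exact: ln_le0.
by nra.
Qed.

Lemma hausdorff_measure_mono s t E : 0 <= s -> s < t ->
  hausdorff_measure s E = 0%E -> hausdorff_measure t E = 0%E.
Proof.
move=> s0 st Hs; have t0 : 0 < t by exact: le_lt_trans st.
apply/hausdorff_measure_snullP => //; apply: snull_hausdorff_delta1 => //.
apply: le_trans (hausdorff_measure_eq0 ltr01 Hs).
apply: le_ereal_inf_tmp => _ [U [EU U1] <-].
apply: (@le_trans _ _ (\sum_(i <oo) diam_pow t (U i))%E).
  by apply: ereal_inf_lbound; exists U.
apply: lee_nneseries => i _; first by move=> _; exact: diam_pow_ge0.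
rewrite /diam_pow; case: pselect => // Ui0.
have := U1 i; have := diam_ge0 Ui0.
case: (diam _) => [d| |]//; rewrite !lee_fin => d0 d1.
by apply: powR_antimono; [rewrite d0 d1 | rewrite s0 ltW].
Qed.

Lemma hausdorff_dim_le E F :
  (forall q : rat, 0 < q -> hausdorff_measure (ratr q) E = 0%E ->
     hausdorff_measure (ratr q) F = 0%E) ->
  (hausdorff_dim F <= hausdorff_dim E)%E.
Proof.
move=> EF; apply: le_ereal_inf_tmp => _ [s [s0 Hs] <-].
apply/lee_addgt0Pr => e e0.
have [q] : exists q : rat, ratr q \in `]s, (s + e)[.
  by apply: rat_in_itvoo; rewrite ltrDl.
rewrite in_itv/= => /andP[sq qe].
have q0 : 0 < q by rewrite -(ltr0q R) (le_lt_trans s0).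
apply: (@le_trans _ _ (ratr q)%:E); last by rewrite -EFinD lee_fin ltW.
apply: ereal_inf_lbound; exists (ratr q); last by [].
split; first by rewrite ler0q ltW.
by apply: (EF _ q0); apply: hausdorff_measure_mono Hs.
Qed.

Lemma hausdorff_dim_eq E F :
  (forall q : rat, 0 < q -> hausdorff_measure (ratr q) E = 0%E <->
     hausdorff_measure (ratr q) F = 0%E) ->
  hausdorff_dim E = hausdorff_dim F.
Proof.
move=> EF; apply/eqP; rewrite eq_le; apply/andP; split;
  by apply: hausdorff_dim_le => q /EF[].
Qed.

Lemma snull_sub s E F : E `<=` F -> snull s F -> snull s E.
Proof.
by move=> EF Fs e /Fs[p [Fp pe]]; exists p; split=> //; exact: subset_trans Fp.
Qed.

Lemma snull_bigcup s (E : nat -> set R) :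
  (forall n, snull s (E n)) -> snull s (\bigcup_n E n).
Proof.
move=> Es e e0.
have /choice[p pE] : forall n, exists p : nat -> rat * rat,
    E n `<=` \bigcup_i qball (p i) /\
    (\sum_(i <oo) (qcost s (p i))%:E <= (e / (2 ^ n.+1)%:R)%:E)%E.
  by move=> n; apply: Es; rewrite divr_gt0// ltr0n expn_gt0.
have c0 q : (0 <= (qcost s q)%:E)%E by rewrite lee_fin powR_ge0.
have /card_esym/ppcard_eqP[f] := card_nat2.
exists (fun i => p (f i).1 (f i).2); split.
  move=> y [n _ /(pE n).1[j _ yj]]; exists (f^-1%FUN (n, j)) => //.
  by rewrite invK ?inE.
rewrite nneseries_esumT//.
rewrite -(@reindex_esum _ _ _ setT setT f
  (fun k => (qcost s (p k.1 k.2))%:E) bij).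
rewrite (_ : setT = setT `*`` (fun=> setT)); last by apply/seteqP; split.
rewrite -(@esum_esum _ _ _ setT (fun=> setT) (fun n i => (qcost s (p n i))%:E))//.
apply: le_trans (epsilon_trick0 xpredT (ltW e0)).
rewrite nneseries_esumT; last first.
  by move=> n; rewrite lee_fin divr_ge0// ltW.
apply: le_esum => n _; rewrite -nneseries_esumT//.
exact: (pE n).2.
Qed.

(* Compactness reduces a countable cover to a list, and lists of pairs of
   rationals form a countable type. *)
Lemma snull_compactP s E : 0 < s -> compact E ->
  snull s E <-> forall k : nat, exists l : seq (rat * rat),
    \sum_(p <- l) qcost s p <= k.+1%:R^-1 /\
    (forall y, E y -> exists2 p, p \in l & qball p y).
Proof.
move=> s0 cE; split.
  move=> Es k; have k0 : 0 < k.+1%:R^-1 :> R by rewrite invr_gt0.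
  have [p [Ep pe]] := Es _ k0.
  move: cE; rewrite compact_cover => /(_ nat setT (fun i => qball (p i))) [].
  - move=> i _; rewrite (_ : qball _ = ball (ratr (p i).1 : R) (ratr (p i).2)).
      exact: ball_open.
    by rewrite -ball_normE; apply/seteqP; split=> y; rewrite /qball/= distrC.
  - exact: Ep.
  - move=> D _ ED; pose N := (\max_(i <- finmap.enum_fset D) i).+1.
    exists [seq p i | i <- iota 0 N]; split.
      rewrite big_map -lee_fin (le_trans _ pe)//.
      apply: le_trans (nneseries_lim_ge N _); last first.
        by move=> ? _ _; rewrite lee_fin powR_ge0.
      by rewrite -sumEFin /index_iota subn0.
    move=> y /ED[i iD yi]; exists (p i) => //.
    apply/mapP; exists i => //; rewrite mem_iota/= add0n ltnS.
    exact: (@leq_bigmax_seq _ _ xpredT id).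
move=> El e e0; pose k := Num.truncn e^-1.
have ke : k.+1%:R^-1 <= e.
  by rewrite -[leRHS]invrK lef_pV2 ?posrE ?invr_gt0// ltW// truncnS_gt.
have [l [lk lE]] := El k.
exists (fun i => nth (0, 0) l i); split.
  move=> y /lE[p pl yp]; exists (index p l) => //.
  by rewrite nth_index.
rewrite (@nneseries_split _ _ 0 (size l)); last first.
  by move=> ? _; rewrite lee_fin powR_ge0.
rewrite add0n [X in (_ + X)%E]eseries0; last first.
  move=> i il _; rewrite nth_default// /qcost/= rmorph0 powR0// gt_eqF//.
by rewrite adde0 sumEFin lee_fin -(big_nth _ xpredT) (le_trans lk).
Qed.

Lemma snull_set1 s (a : R) : 0 < s -> snull s [set a].
Proof.
move=> s0; apply/snull_hausdorff_delta1 => //.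
apply: ereal_inf_lbound; exists (fun i => if i is 0 then [set a] else set0).
  split; first by exists 0.
  case=> [|i]; apply: ge_ereal_sup => _ [x /= xa [y ya <-]] //.
  by rewrite xa ya subrr normr0 lee_fin.
apply: eseries0 => -[|i] _ _; rewrite /diam_pow; case: pselect => // -[] //.
move=> b ba; have -> : diam [set a] = 0%E.
  apply/eqP; rewrite eq_le diam_ge0 ?andbT; last by exists a.
  apply: ge_ereal_sup => _ [x -> [y -> <-]].
  by rewrite subrr normr0.
by rewrite /= powR0// gt_eqF.
Qed.

Lemma snull_setU s E F : snull s E -> snull s F -> snull s (E `|` F).
Proof.
move=> Es Fs; rewrite -bigcup2E; apply: snull_bigcup => -[|[|j]] //=.
exact: snull_sub Es.
Qed.

End HausdorffNull.

Lemma powRN_eventually_le (R : realType) (kappa d : R) : 0 < kappa -> 0 < d ->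
  exists M : nat, forall N : nat, (M <= N)%N -> N%:R `^ (- kappa) <= d.
Proof.
move=> k0 d0; pose b := d `^ (- kappa^-1).
exists (Num.truncn b).+1 => N MN.
have bN : b <= N%:R by rewrite (le_trans (ltW (truncnS_gt b)))// ler_nat.
have b0 : 0 < b by rewrite powR_gt0.
have N0 : 0 < N%:R :> R by exact: lt_le_trans bN.
have : b `^ kappa <= N%:R `^ kappa.
  by rewrite ge0_ler_powR ?nnegrE// ltW.
rewrite /b -powRrM mulNr mulVf ?gt_eqF// (powR_inv1 (ltW d0)) => dN.
by rewrite powRN -[leRHS]invrK lef_pV2// posrE ?invr_gt0// powR_gt0.
Qed.

Lemma dist_le_finite_limit (R : realType) (a : nat -> R) (N : nat) (c y : R) :
  (forall e, 0 < e -> exists2 z, `|z - y| < e &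
     exists n, (1 <= n <= N)%N /\ `|a n - z| <= c + e) ->
  exists n, (1 <= n <= N)%N /\ `|a n - y| <= c.
Proof.
move=> lim; apply: contrapT => far.
have {}far n : (1 <= n <= N)%N -> c < `|a n - y|.
  by move=> nN; rewrite ltNge; apply/negP => an; apply: far; exists n.
have [e e0 gap] : exists2 e, 0 < e &
    forall n, (1 <= n <= N)%N -> c + e + e <= `|a n - y|.
  elim: N far {lim} => [|N IH] far.
    by exists 1 => // n /andP[n1 n0]; move: (leq_trans n1 n0).
  have [|e e0 gap] := IH.
    by move=> n /andP[n1 nN]; apply: far; rewrite n1 ltnW.
  have cN : c < `|a N.+1 - y| by apply: far; rewrite leqnn.
  exists (Num.min e ((`|a N.+1 - y| - c) / 2)).
    by rewrite lt_min e0 divr_gt0// subr_gt0.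
  move=> n /andP[n1]; rewrite leq_eqVlt => /predU1P[->|nN].
    have : Num.min e ((`|a N.+1 - y| - c) / 2) <= (`|a N.+1 - y| - c) / 2.
      by rewrite ge_min lexx orbT.
    lra.
  have : Num.min e ((`|a N.+1 - y| - c) / 2) <= e by rewrite ge_min lexx.
  have : c + e + e <= `|a n - y| by apply: gap; rewrite n1.
  lra.
have [z zy [n [nN anz]]] := lim e e0.
have := gap n nN; rewrite leNgt => /negP; apply.
rewrite (le_lt_trans (ler_distD z _ _))//; lra.
Qed.

Section UniformApproximation.
Variables (R : realType) (T : R -> R) (kappa : R).
Implicit Types (x y s : R) (l : seq (rat * rat)).

Local Notation U := (Ukappa T kappa).

Lemma Ukappa_sub_image x : 0 < kappa -> U x `<=` U (T x) `|` [set T x].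
Proof.
move=> k0 y [yI [i [i1 Ui]]]; have [->|yT] := eqVneq y (T x); first by right.
left; split=> //.
have d0 : 0 < `|T x - y| by rewrite normr_gt0 subr_eq0 eq_sym.
have [M Md] := powRN_eventually_le k0 d0.
exists (maxn i M); split; first by rewrite leq_max i1.
move=> N; rewrite geq_max => /andP[iN MN].
have [[|[|n]] [nN nd]] := Ui N iN; first by [].
  by move: nd; rewrite ltNge Md.
by exists n.+1; split; [exact: ltnW | rewrite -iterSr].
Qed.

(* [Ukappa] with closed balls and a fixed starting rank: compact, and
   exhausting [Ukappa] up to a countable set. *)
Definition Kset (i : nat) x : set R :=
  [set y | unitI y /\ forall N : nat, (i < N)%N ->
     exists n, (1 <= n <= N)%N /\ `|iter n T x - y| <= N%:R `^ (- kappa)].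

Lemma Ukappa_sub_Kset x : U x `<=` \bigcup_i Kset i x.
Proof.
move=> y [yI [i [_ Ui]]]; exists i => //; split; first exact: set_mem.
by move=> N /ltnW/Ui[n [nN nd]]; exists n; split=> //; exact: ltW.
Qed.

Lemma Kset_sub_Ukappa i x : Kset i x `<=` U x `|`
  \bigcup_n \bigcup_N \bigcup_b
    [set iter n T x + (-1) ^+ b * N%:R `^ (- kappa)].
Proof.
move=> y [yI Ky].
have [|yD] := pselect ((\bigcup_n \bigcup_N \bigcup_b
    [set iter n T x + (-1) ^+ b * N%:R `^ (- kappa)]) y); first by right.
left; split; first exact: mem_set.
exists i.+1; split=> // N /Ky[n [nN nd]]; exists n; split=> //.
rewrite lt_neqAle nd andbT; apply/negP => /eqP dE; apply: yD.
exists n => //; exists N => //; rewrite -dE.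
have [d0|d0] := leP 0 (iter n T x - y).
  by exists 1%N => //=; rewrite expr1 ger0_norm//; lra.
by exists 0%N => //=; rewrite expr0 ltr0_norm//; lra.
Qed.

Lemma snull_Ukappa s x : 0 < s ->
  snull s (U x) <-> forall i, snull s (Kset i x).
Proof.
move=> s0; split=> [Us i|Ks].
  apply: (snull_sub (@Kset_sub_Ukappa i x)); apply: snull_setU => //.
  do 3 apply: snull_bigcup => ?; exact: snull_set1.
by apply: (snull_sub (@Ukappa_sub_Kset x)); exact: snull_bigcup.
Qed.

Lemma compact_Kset i x : compact (Kset i x).
Proof.
apply: (@subclosed_compact _ (Kset i x) (@unitI R)); first last.
- by move=> y [].
- exact: segment_compact.
move=> y Ky; split.
  have : closure (@unitI R) y.
    by apply: closureS Ky => z [].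
  by rewrite -(closure_id (@unitI R)).1//; exact: itv_closed.
move=> N iN; apply: (@dist_le_finite_limit _ (fun n => iter n T x)) => e e0.
have [z [[_ /(_ N iN)[n [nN nz]]] yz]] := Ky _ (nbhsx_ballx y e e0).
exists z; first by move: yz; rewrite -ball_normE/= distrC.
by exists n; split=> //; lra.
Qed.

Let invS (k : nat) : R := k.+1%:R^-1.

Definition Kapprox (i : nat) l (k : nat) (q : rat) : set R :=
  [set x | [/\ (- invS k <= (ratr q : R) <= 1 + invS k),
    (forall p, p \in l -> ratr p.2 - invS k <= `|ratr q - ratr p.1 : R|) &
    forall N : nat, (i < N <= k)%N -> exists n, (1 <= n <= N)%N /\
       `|iter n T x - ratr q| <= N%:R `^ (- kappa) + invS k]].

(* Compactness of [Kset] turns the failure of a finite cover into a countable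
   condition on the orbit of [x]. *)
Lemma Kset_coverP i l x :
  (forall y, Kset i x y -> exists2 p, p \in l & @qball R p y) <->
  (~` \bigcap_k \bigcup_q Kapprox i l k q) x.
Proof.
split=> [cov app|napp y Ky]; last first.
  apply: contrapT => nl; apply: napp => k _.
  have k0 : 0 < invS k :> R by rewrite /invS invr_gt0.
  have [q] : exists q : rat, ratr q \in `]y, (y + invS k)[.
    by apply: rat_in_itvoo; rewrite ltrDl.
  rewrite in_itv/= => /andP[yq qy].
  have qyE : `|y - ratr q| < invS k.
    by rewrite ler0_norm; lra.
  exists q => //; split.
  - by case: Ky; rewrite /unitI/= in_itv/= => /andP[y0 y1] _; lra.
  - move=> p pl; have [//|qp] := leP; exfalso; apply: nl; exists p => //.
    by rewrite /qball/= (le_lt_trans (ler_distD (ratr q) _ _))//; lra.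
  - move=> N /andP[iN _]; have [n [nN nd]] := Ky.2 N iN.
    exists n; split=> //.
    by rewrite (le_trans (ler_distD y _ _))//; lra.
have /choice[q qP] : forall k, exists q, Kapprox i l k q x.
  by move=> k; have [q _ Pq] := app k Logic.I; exists q.
have inv1 (k : nat) : invS k <= 1 :> R by rewrite /invS invf_le1 ?ler1n.
have : ((fun k => ratr (q k) : R) @ \oo) `[-1, 2]%classic.
  exists 0%N => // k _ /=; have [q01 _ _] := qP k.
  by rewrite in_itv/=; have := inv1 k; lra.
move=> /(@segment_compact R (-1) 2)[y [_ ycl]].
have near e (k0 : nat) : 0 < e -> exists k : nat,
    [/\ (k0 <= k)%N, invS k < e & `|ratr (q k) - y| < e].
  move=> e0; pose k1 := Num.truncn e^-1.
  pose tail : set R := [set ratr (q k) | k in [set k | (maxn k0 k1 <= k)%N]].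
  have tailP : ((fun k => ratr (q k) : R) @ \oo) tail.
    by exists (maxn k0 k1) => // k kk; exists k.
  have [_ [[k kk <-] yk]] := ycl tail _ tailP (nbhsx_ballx y e e0).
  move: kk; rewrite /= geq_max => /andP[k0k k1k].
  exists k; split=> //; last by move: yk; rewrite -ball_normE/= distrC.
  rewrite /invS -[ltRHS]invrK ltf_pV2 ?posrE ?invr_gt0//.
  by rewrite (lt_le_trans (truncnS_gt _))// ler_nat.
have [|p pl] := cov y.
  split.
    rewrite /unitI/= in_itv/=; apply/andP; split.
      apply/ler_addgt0Pr => e e0; have e20 : 0 < e / 2 by rewrite divr_gt0.
      have [k [_ ke]] := near _ 0%N e20.
      rewrite ltr_norml => /andP[qy1 qy2].
      by have [/andP[q0 q1] _ _] := qP k; lra.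
    apply/ler_addgt0Pr => e e0; have e20 : 0 < e / 2 by rewrite divr_gt0.
    have [k [_ ke]] := near _ 0%N e20.
    rewrite ltr_norml => /andP[qy1 qy2].
    by have [/andP[q0 q1] _ _] := qP k; lra.
  move=> N iN; apply: (@dist_le_finite_limit _ (fun n => iter n T x)) => e e0.
  have [k [Nk ke qy]] := near e N e0; exists (ratr (q k)) => //.
  have [_ _ /(_ N)] := qP k; rewrite iN Nk => /(_ isT)[n [nN nd]].
  by exists n; split=> //; lra.
rewrite /qball/= => yp.
have e0 : 0 < (ratr p.2 - `|y - ratr p.1|) / 2 by rewrite divr_gt0// subr_gt0.
have [k [_ ke qy]] := near _ 0%N e0.
have [_ /(_ p pl) + _] := qP k; rewrite leNgt => /negP; apply.
by rewrite (le_lt_trans (ler_distD y _ _))//; lra.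
Qed.

End UniformApproximation.

Section Measurability.
Variables (R : realType) (T : R -> R) (kappa : R).
Hypothesis mT : measurable_fun [set: measurableTypeR R] (T : _ -> measurableTypeR R).

Local Notation U := (Ukappa T kappa).

Lemma measurable_iter n :
  measurable_fun [set: measurableTypeR R] (iter n T : _ -> measurableTypeR R).
Proof.
elim: n => [|n IH]; first exact: measurable_id.
exact: (measurableT_comp mT IH).
Qed.

Lemma measurable_prop_cst (P : Prop) :
  measurable ([set _ | P] : set (measurableTypeR R)).
Proof.
have [p|np] := pselect P.
  by rewrite (_ : mkset _ = setT)//; apply/seteqP; split.
by rewrite (_ : mkset _ = set0)//; apply/seteqP; split.
Qed.

Lemma measurable_Kapprox i l k q :
  measurable (Kapprox T kappa i l k q : set (measurableTypeR R)).
Proof.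
pose c : Prop := (- k.+1%:R^-1 <= (ratr q : R) <= 1 + k.+1%:R^-1) /\
  (forall p, p \in l -> ratr p.2 - k.+1%:R^-1 <= `|ratr q - ratr p.1 : R|).
rewrite (_ : Kapprox _ _ _ _ _ _ =
  [set _ | c] `&` \bigcap_(N in [set N | (i < N <= k)%N])
  \bigcup_(n in [set n | (1 <= n <= N)%N])
   (iter n T @^-1` [set z | `|z - ratr q| <= N%:R `^ (- kappa) + k.+1%:R^-1])).
  apply: measurableI; first exact: measurable_prop_cst.
  apply: bigcap_measurableType => N _; apply: bigcup_measurable => n _.
  rewrite -[X in measurable X]setTI; apply: measurable_iter => //.
  pose e : R := N%:R `^ (- kappa) + k.+1%:R^-1.
  rewrite (_ : mkset _ = `[ratr q - e, ratr q + e]%classic).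
    exact: measurable_itv.
  by apply/seteqP; split=> z; rewrite /= in_itv/= ler_distl.
apply/seteqP; split=> x.
  by move=> [c1 c2 xN]; split=> // N /xN[n [nN nd]]; exists n.
by move=> [[c1 c2] xN]; split=> // N /xN[n nN nd]; exists n.
Qed.

Lemma measurable_snull_Ukappa s : 0 < s ->
  measurable ([set x | snull s (U x)] : set (measurableTypeR R)).
Proof.
move=> s0.
rewrite (_ : mkset _ = \bigcap_i \bigcap_k \bigcup_l
  ([set _ | \sum_(p <- l) qcost s p <= k.+1%:R^-1] `&`
   ~` \bigcap_j \bigcup_q Kapprox T kappa i l j q)).
  apply: bigcap_measurableType => i _; apply: bigcap_measurableType => k _.
  apply: countable_bigcupT_measurable; first exact: countableP.
  move=> l; apply: measurableI; first exact: measurable_prop_cst.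
  apply: measurableC; apply: bigcap_measurableType => j _.
  apply: bigcupT_measurable_rat => q; exact: measurable_Kapprox.
apply/seteqP; split=> x /=.
  move=> /(snull_Ukappa _ _ _ s0) Ux i _ k _.
  have [l [lk lK]] := (snull_compactP s0 (@compact_Kset _ T kappa i x)).1 (Ux i) k.
  by exists l => //; split=> //; apply/Kset_coverP.
move=> Ux; apply/(snull_Ukappa _ _ _ s0) => i.
apply/(snull_compactP s0 (@compact_Kset _ T kappa i x)) => k.
have [l _ [lk lK]] := Ux i Logic.I k Logic.I.
by exists l; split=> //; apply/Kset_coverP.
Qed.

Definition Ukappa_graph : set (measurableTypeR R * measurableTypeR R) :=
  [set z | U z.1 z.2].

Lemma measurable_Ukappa_graph : measurable Ukappa_graph.
Proof.
rewrite (_ : Ukappa_graph = (snd @^-1` (@unitI R)) `&`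
  \bigcup_(i in [set i | (1 <= i)%N]) \bigcap_(N in [set N | (i <= N)%N])
  \bigcup_(n in [set n | (1 <= n <= N)%N])
   ((fun z => iter n T z.1 - z.2) @^-1`
      `](- (N%:R `^ (- kappa))), (N%:R `^ (- kappa))[%classic)).
  apply: measurableI.
    rewrite -[X in measurable X]setTI; apply: measurable_snd => //.
    exact: measurable_itv.
  apply: bigcup_measurable => i _; apply: bigcap_measurableType => N _.
  apply: bigcup_measurable => n _.
  rewrite -[X in measurable X]setTI.
  apply: (measurable_funB (measurableT_comp (measurable_iter n) measurable_fst)
    measurable_snd) => //.
apply/seteqP; split=> -[x y]; rewrite /Ukappa_graph/Ukappa/=.
  move=> [yI [i [i1 Ui]]]; split; first exact: set_mem.
  exists i => // N /Ui[n [nN nd]]; exists n => //=.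
  by rewrite in_itv/= -ltr_norml.
move=> [yI [i i1 Ui]]; split; first exact: mem_set.
exists i; split=> // N /Ui[n nN]; rewrite /= in_itv/= -ltr_norml => nd.
by exists n.
Qed.

Lemma Ukappa_xsection x : xsection Ukappa_graph x = U x.
Proof. by apply/seteqP; split=> y; rewrite /xsection/= inE. Qed.

Lemma measurable_Ukappa x : measurable (U x : set (measurableTypeR R)).
Proof.
rewrite -Ukappa_xsection; apply: measurable_xsection.
exact: measurable_Ukappa_graph.
Qed.

Lemma measurable_fun_Ukappa :
  measurable_fun [set: measurableTypeR R] (fun x => lebesgue_measure (U x)).
Proof.
have := measurable_fun_xsection (@lebesgue_measure R) measurable_Ukappa_graph.
congr measurable_fun; apply/funext => x /=.
by rewrite Ukappa_xsection.
Qed.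

Lemma lebesgue_measure_Ukappa_le x : 0 < kappa ->
  (lebesgue_measure (U x) <= lebesgue_measure (U (T x)))%E.
Proof.
move=> k0.
apply: (@le_trans _ _ (lebesgue_measure (U (T x) `|` [set T x]))).
  apply: le_measure; rewrite ?inE.
  - exact: measurable_Ukappa.
  - by apply: measurableU; [exact: measurable_Ukappa | exact: measurable_set1].
  - exact: Ukappa_sub_image.
apply: (le_trans
  (measureU2 _ (measurable_Ukappa (T x)) (measurable_set1 (T x)))).
by rewrite [X in (_ + X)%E](lebesgue_measure_set1 (T x)) adde0.
Qed.

End Measurability.

Lemma ereal_rat_between (R : realType) (a b : \bar R) : (a < b)%E ->
  exists q : rat, (a <= (ratr q)%:E < b)%E.
Proof.
have rat_in (u v : R) : u < v -> exists q : rat, u < ratr q < v.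
  by move=> /rat_in_itvoo[q]; rewrite in_itv/=; exists q.
case: a b => [u| |] [v| |] //=; rewrite ?lte_fin => uv.
- by have [q /andP[uq qv]] := rat_in _ _ uv; exists q; rewrite lee_fin ltW.
- have [|q /andP[uq qv]] := rat_in u (u + 1); first by rewrite ltrDl.
  by exists q; rewrite lee_fin ltW//= ltry.
- have [|q /andP[uq qv]] := rat_in (v - 1) v; first by rewrite ltrBlDr ltrDl.
  by exists q; rewrite leNye lte_fin.
- by exists 0; rewrite leNye ltry.
Qed.

Section Ergodic.
Variables (R : realType) (T : R -> R) (nu : probability (measurableTypeR R) R).
Hypothesis mT : measurable_fun [set: measurableTypeR R] (T : _ -> measurableTypeR R).
Hypothesis TI : forall x, unitI x -> unitI (T x).
Hypothesis nuI : nu (@unitI R) = 1%E.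
Hypothesis Tinv : T_invariant T nu.
Hypothesis Terg : T_ergodic T nu.

Lemma ergodic_zero_one (A : set (measurableTypeR R)) : measurable A ->
  A `<=` @unitI R -> (forall x, A x -> A (T x)) -> (nu A = 0 \/ nu A = 1)%E.
Proof.
move=> mA AI AT; pose F n := @unitI R `&` iter n T @^-1` A.
have mI : measurable (@unitI R : set (measurableTypeR R)) by exact: measurable_itv.
have mF n : measurable (F n : set (measurableTypeR R)).
  exact: (measurable_funTS (measurable_iter mT n)).
have nuF n : nu (F n) = nu A.
  elim: n => [|n <-].
    by congr (nu _); apply/seteqP; split=> [x []//|x Ax]; split=> //; exact: AI.
  rewrite -[RHS]Tinv//; congr (nu _); apply/seteqP; split=> x.
    move=> [xI xA]; split=> //; split; first exact: TI.
    by rewrite /preimage/= -iterSr.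
  by move=> [xI [_]]; rewrite /preimage/= -iterSr; split.
have mB : measurable (\bigcup_n F n : set (measurableTypeR R)).
  exact: bigcupT_measurable.
have -> : nu A = nu (\bigcup_n F n).
  have := @nondecreasing_cvg_mu _ _ _ nu F mF mB.
  rewrite (_ : nu \o F = fun=> nu A); last by apply/funext => n /=.
  move=> /(_ _)/cvg_lim <- //; first by rewrite lim_cst.
  apply/nondecreasing_seqP => n; apply/subsetPset => x [xI xn]; split=> //=.
  exact: AT.
apply: Terg => //; first by move=> x [n _ []].
apply/seteqP; split=> x.
  move=> [xI [n _ [_ xn]]]; exists n.+1 => //; split=> //.
  by rewrite /preimage/mkset iterSr.
move=> [n _ [xI xn]]; split=> //; exists n => //; split; first exact: TI.
by rewrite /preimage/mkset -iterSr; apply: AT.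
Qed.

Lemma ergodic_ae_constant (V : pointedType) (f : R -> V)
    (A : rat -> set (measurableTypeR R)) :
  (forall q, measurable (A q)) -> (forall q, A q `<=` @unitI R) ->
  (forall q x, A q x -> A q (T x)) ->
  (forall x y, unitI x -> unitI y -> (forall q, A q x <-> A q y) -> f x = f y) ->
  exists c, {ae nu, forall x, f x = c}.
Proof.
move=> mA AI AT Af.
pose N q : set (measurableTypeR R) := if nu (A q) == 0%E then A q else ~` A q.
have N0 q : nu.-negligible (N q).
  rewrite /N; case: ifPn => [/eqP A0|A0]; first exact/negligibleP.
  apply/negligibleP; first exact: measurableC.
  apply: (eq_trans (probability_setC nu (mA q))).
  by have [A0'|->] := ergodic_zero_one (mA q) (@AI q) (AT q);
    [rewrite A0' eqxx in A0 | rewrite subee].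
have NI : nu.-negligible (~` (@unitI R) : set (measurableTypeR R)).
  have mI : measurable (@unitI R : set (measurableTypeR R)) by exact: measurable_itv.
  apply/negligibleP; first exact: measurableC.
  by apply: (eq_trans (probability_setC nu mI)); rewrite nuI subee.
pose M n := if unpickle n is Some q then N q else set0.
have MN q : M (pickle q) = N q by rewrite /M pickleK.
pose Z := ~` (@unitI R) `|` \bigcup_n M n.
have Z0 : nu.-negligible (Z : set (measurableTypeR R)).
  apply: negligibleU => //; apply: negligible_bigcup => n.
  by rewrite /M; case: unpickle => [q|]; [exact: N0 | exact: negligible_set0].
have ZN x q : ~ Z x -> ~ N q x.
  by move=> Zx Nx; apply: Zx; right; exists (pickle q); last rewrite MN.
have ZI x : ~ Z x -> unitI x.
  by move=> Zx; apply: contrapT => xI; apply: Zx; left.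
have [[x0 x0Z]|noZ] := pselect (exists x, ~ Z x).
  exists (f x0); apply: negligibleS Z0 => x fx; apply: contrapT => xZ.
  apply: fx; apply: Af; [exact: ZI | exact: ZI |] => q.
  move: (ZN _ q xZ) (ZN _ q x0Z); rewrite /N /setC.
  by case: ifP => _ /=; rewrite ?notK; tauto.
exists point; apply: negligibleS Z0 => x _; apply: contrapT => xZ.
by apply: noZ; exists x.
Qed.

Lemma Ukappa_ae_constant kappa : 0 < kappa ->
  (exists c : \bar R,
     {ae nu, forall x, lebesgue_measure (Ukappa T kappa x) = c}) /\
  (exists d : \bar R,
     {ae nu, forall x, hausdorff_dim (Ukappa T kappa x) = d}).
Proof.
move=> k0.
have mI : measurable (@unitI R : set (measurableTypeR R)) by exact: measurable_itv.
split.
  pose A q := [set x | unitI x /\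
    ((ratr q)%:E < lebesgue_measure (Ukappa T kappa x))%E].
  apply: (@ergodic_ae_constant _ _ A).
  - move=> q; rewrite (_ : A q = @unitI R `&` [set x |
        ((ratr q)%:E < lebesgue_measure (Ukappa T kappa x))%E])//.
    apply: emeasurable_fun_o_infty => //.
    by apply: measurable_funTS; exact: (measurable_fun_Ukappa _ mT).
  - by move=> q x [].
  - move=> q x [xI qx]; split; first exact: TI.
    exact: lt_le_trans qx (lebesgue_measure_Ukappa_le mT x k0).
  - have Ale x y : unitI x -> unitI y -> (forall q, A q x <-> A q y) ->
        (lebesgue_measure (Ukappa T kappa x) <=
         lebesgue_measure (Ukappa T kappa y))%E.
      move=> xI yI xy; rewrite leNgt; apply/negP => /ereal_rat_between.
      move=> [q /andP[yq qx]]; have [_] := (xy q).1 (conj xI qx).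
      by rewrite ltNge yq.
    move=> x y xI yI xy; apply/eqP; rewrite eq_le !Ale// => q.
    by split=> /xy.
pose A q := [set x | unitI x /\
  (0 < q /\ ~ snull (ratr q) (Ukappa T kappa x))].
apply: (@ergodic_ae_constant _ _ A).
- move=> q; have [q0|q0] := ltP 0 q; last first.
    rewrite (_ : A q = set0)//; apply/seteqP; split=> // x [_ []].
    by rewrite ltNge q0.
  rewrite (_ : A q = @unitI R `&` ~` [set x | snull (ratr q) (Ukappa T kappa x)]).
    apply: measurableI => //; apply: measurableC.
    by apply: (measurable_snull_Ukappa _ mT); rewrite ltr0q.
  by apply/seteqP; split=> x [xI]; [move=> []|]; split.
- by move=> q x [].
- move=> q x [xI [q0 xq]]; split; first exact: TI.
  split=> // Tq; apply: xq; apply: (snull_sub (Ukappa_sub_image k0)).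
  by apply: snull_setU => //; apply: snull_set1; rewrite ltr0q.
- move=> x y xI yI xy; apply: hausdorff_dim_eq => q q0.
  have q0' : 0 < ratr q :> R by rewrite ltr0q.
  rewrite !hausdorff_measure_snullP//.
  have [xyq yxq] := xy q; split=> [xq|yq]; apply: contrapT => nq.
    by case: (yxq (conj yI (conj q0 nq))) => _ [].
  by case: (xyq (conj xI (conj q0 nq))) => _ [].
Qed.

End Ergodic.

Lemma partition_cover (R : realType) (Q : nat) (a : nat -> R) (x : R) :
  a 0%N <= x <= a Q ->
  exists i, x = a i \/ (i < Q)%N /\ Ipart a i x.
Proof.
elim: Q => [|Q IH] /andP[x0 xQ].
  by exists 0%N; left; apply/eqP; rewrite eq_le xQ x0.
have [xaQ|aQx] := leP x (a Q).
  have [|i [->|[iQ xi]]] := IH; first by rewrite x0.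
    by exists i; left.
  by exists i; right; split=> //; exact: ltnW.
have [->|xQ'] := eqVneq x (a Q.+1); first by exists Q.+1; left.
exists Q; right; split=> //; rewrite /Ipart/= in_itv/= aQx.
by rewrite lt_neqAle xQ' xQ.
Qed.

Lemma expanding_markov_map_measurable (R : realType) (T : R -> R) :
  expanding_markov_map T ->
  measurable_fun (@unitI R : set (measurableTypeR R)) (T : _ -> measurableTypeR R).
Proof.
move=> [TI [Q [a [Q0 [a0 [aQ [aS [_ [TC2 _]]]]]]]]].
pose E i : set (measurableTypeR R) :=
  [set a i] `|` (if (i < Q)%N then Ipart a i else set0).
have mE i : measurable (E i).
  apply: measurableU; first exact: measurable_set1.
  by case: ifP => _; [exact: measurable_itv | exact: measurable0].
have : measurable_fun (\bigcup_i E i) (T : _ -> measurableTypeR R).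
  apply/measurable_fun_bigcup => // i; apply/measurable_funU.
  - exact: measurable_set1.
  - by case: ifP => _; [exact: measurable_itv | exact: measurable0].
  split; first exact: measurable_fun_set1.
  case: ifPn => iQ; last exact: measurable_fun_set0.
  have [_ [g [[dg _] gT]]] := TC2 i iQ.
  apply: (eq_measurable_fun g); first by move=> x xi; exact: gT.
  apply: measurable_funTS; apply: continuous_measurable_fun => x.
  exact/differentiable_continuous/derivable1_diffP.
move=> mTE; apply: measurable_funS mTE; first exact: bigcupT_measurable.
move=> x; rewrite /unitI/= in_itv/= -a0 -aQ => /partition_cover[i xi].
exists i => //; case: xi => [->|[iQ xi]]; first by left.
by right; rewrite iQ.
Qed.

Theorem theorem1p1 (R : realType) (T : R -> R)
  (nu : probability (measurableTypeR R) R) :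
  expanding_markov_map T ->
  nu (@unitI R) = 1%E ->
  T_invariant T nu ->
  T_ergodic T nu ->
  forall kappa : R, 0 < kappa ->
    (exists c : \bar R,
       {ae nu, forall x, lebesgue_measure (Ukappa T kappa x) = c}) /\
    (exists d : \bar R,
       {ae nu, forall x, hausdorff_dim (Ukappa T kappa x) = d}).
Proof.
move=> TM nuI Tinv Terg kappa k0.
have mI : measurable (@unitI R : set (measurableTypeR R)) by exact: measurable_itv.
have mT := expanding_markov_map_measurable TM.
have TI x : unitI x -> unitI (T x).
  by move=> xI; apply/set_mem/TM.1/mem_set.
(* [T] is unconstrained outside [unitI]; this modification is Borel on [R]. *)
pose T' : R -> R := (T : measurableTypeR R -> measurableTypeR R) \_ (@unitI R).
have T'E x : unitI x -> T' x = T x.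
  by move=> xI; rewrite /T' patchT// mem_set.
have mT' : measurable_fun [set: measurableTypeR R] (T' : _ -> measurableTypeR R).
  exact: (measurable_restrictT _ mI).1.
have preim A : @unitI R `&` T' @^-1` A = @unitI R `&` T @^-1` A.
  by apply/seteqP; split=> x [xI]; rewrite /preimage/= T'E.
have UE x : unitI x -> Ukappa T' kappa x = Ukappa T kappa x.
  move=> xI; have iterE n : iter n T' x = iter n T x /\ unitI (iter n T x).
    elim: n => //= n [-> nI]; rewrite T'E//; split=> //; exact: TI.
  apply/seteqP; split=> y [yI [i [i1 Ui]]]; split=> //; exists i; split=> //.
    by move=> N /Ui[n [nN nd]]; exists n; rewrite -(iterE n).1.
  by move=> N /Ui[n [nN nd]]; exists n; rewrite (iterE n).1.
have NI : nu.-negligible (~` (@unitI R) : set (measurableTypeR R)).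
  apply/negligibleP; first exact: measurableC.
  by apply: (eq_trans (probability_setC nu mI)); rewrite nuI subee.
have transfer (f : set R -> \bar R) :
    (exists c, {ae nu, forall x, f (Ukappa T' kappa x) = c}) ->
    exists c, {ae nu, forall x, f (Ukappa T kappa x) = c}.
  move=> [c fc]; exists c; apply: negligibleS (negligibleU NI fc) => x /= fx.
  have [xI|] := pselect (unitI x); last by left.
  by right; rewrite /= UE.
have [Hl Hd] := @Ukappa_ae_constant R T' nu mT'
  (fun x xI => eq_ind_r _ (TI x xI) (T'E x xI)) nuI
  (fun A mA => eq_trans (congr1 nu (preim A)) (Tinv A mA))
  (fun A mA AI TA => Terg A mA AI (eq_trans (esym (preim A)) TA)) kappa k0.
split; first exact: (transfer lebesgue_measure).
exact: (transfer (@hausdorff_dim R)).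
Qed.
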